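(* Let $2\leq l\leq k$ be integers and let $P_{k,l}$ be the polynomial such that $\lambda_l(n,k)=(n-k-l)!\,P_{k,l}(n)$ for all integers $n>2k$ coprime to $k$. (i) One of the roots of $P_{k,l}$ is $l$. (ii) If $l$ is odd, then $2k$ is a root of $P_{k,l}$.
   Context: For positive integers $k<n/2$, $\mathbb{Z}_n$ is the set of integers modulo $n$ and $\mathbb{Z}_n^{(k)}$ is the set of its $k$-element subsets. For a bijection $\pi:\mathbb{Z}_n\to\mathbb{Z}_n$, let $\mathcal{F}_\pi=\{\{\pi((i-1)k+1),\ldots,\pi(ik)\} : i\in\mathbb{Z}_n\}\subset\mathbb{Z}_n^{(k)}$. An $(n,k)$-wreath is a family of the form $\mathcal{F}_\pi$; $\mathcal{W}_{n,k}$ is the set of all of them. The $(n,k)$-wreath matrix $M$ has rows and columns labelled by $\mathcal{W}_{n,k}$ and entries $M_{\mathcal{F},\mathcal{F}'}=|\mathcal{F}\cap\mathcal{F}'|$. Definition of $\lambda_l=\lambda_l(n,k)$ for $2\le l\le k$. Let $S_n$ be the group of permutations of $\mathbb{Z}_n$. Let $V$ be the complex vector space with basis $\{e_{\mathcal{F}}:\mathcal{F}\in\mathcal{W}_{n,k}\}$, with $S_n$ acting by $\tau e_{\mathcal{F}_\pi}=e_{\mathcal{F}_{\tau\pi}}$; $M$ acts on $V$. Let $V_k$ be the permutation $\mathbb{C}S_n$-module with basis $\{v_T:T\in\mathbb{Z}_n^{(k)}\}$, which decomposes as $V_k=\bigoplus_{i=0}^k U_i$ with $U_i$ isomorphic to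 the Specht module $S^{(n-i,i)}$. Let $\Phi:V_k\to V$ be the $\mathbb{C}S_n$-homomorphism $\Phi(v_T)=\sum_{\mathcal{F}\ni T}e_{\mathcal{F}}$, and let $E_l=\Phi(U_l)$, which for $2\le l\le k$ is isomorphic to $U_l$. The matrix $M$ acts on $E_l$ by multiplication by a scalar, and $\lambda_l$ denotes this scalar. For fixed $2\le l\le k$, the paper shows that there is a (necessarily unique) polynomial $P_{k,l}$ with $\lambda_l(n,k)=(n-k-l)!\,P_{k,l}(n)$ for all integers $n>2k$ coprime to $k$. *)

(* Defs.v *)
From HB Require Import structures.
From mathcomp Require Import all_boot all_order all_fingroup all_algebra all_character.
From mathcomp Require Import complex reals.
Set Implicit Arguments.
Unset Strict Implicit.
Unset Printing Implicit Defensive.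
Import GRing.Theory.
Local Open Scope ring_scope.

(* 'Z_n has n elements only for 1 < n; the theorem only uses n > 2k >= 4. *)

Section Wreaths.
Variables n k : nat.

(* With i ranging over 'Z_n, (i - 1) k + j is computed modulo n. *)
Definition wreath_block (p : {perm 'Z_n}) (i : 'Z_n) : {set 'Z_n} :=
  [set p ((i - 1) * k%:R + j.+1%:R) | j : 'I_k].

Definition wreath (p : {perm 'Z_n}) : {set {set 'Z_n}} :=
  [set wreath_block p i | i : 'Z_n].

Definition wreaths : {set {set {set 'Z_n}}} :=
  [set wreath p | p : {perm 'Z_n}].

Definition ksets : {set {set 'Z_n}} := [set T : {set 'Z_n} | #|T| == k].

End Wreaths.

(* V and V_k are the row-vector spaces whose coordinates enumerate [wreaths n k]
   and [ksets n k]; linear maps act by multiplication on the right. *)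

Definition wreath_mx (F : fieldType) n k : 'M[F]_#|wreaths n k| :=
  \matrix_(i < #|wreaths n k|, j < #|wreaths n k|)
    #|enum_val i :&: enum_val j|%:R.

Definition Phi_mx (F : fieldType) n k : 'M[F]_(#|ksets n k|, #|wreaths n k|) :=
  \matrix_(i < #|ksets n k|, j < #|wreaths n k|)
    (enum_val i \in enum_val j)%:R.

Definition kset_vec (F : fieldType) n k (T : {set 'Z_n}) : 'rV[F]_#|ksets n k| :=
  \row_(j < #|ksets n k|) (enum_val j == T)%:R.

(* The permutation module V_k.  In MathComp (s * t) x = t (s x), so this
   (right) representation sends v_T to v_(s T) for the usual left action. *)
Definition kset_mx (F : fieldType) n k (s : {perm 'Z_n}) : 'M[F]_#|ksets n k| :=
  \matrix_(i < #|ksets n k|) kset_vec F k (s @: enum_val i).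

Lemma imset_kset n k (s : {perm 'Z_n}) (T : {set 'Z_n}) :
  (s @: T \in ksets n k) = (T \in ksets n k).
Proof. by rewrite !inE card_imset //; apply: perm_inj. Qed.

Lemma kset_vec_out (F : fieldType) n k (T : {set 'Z_n}) :
  T \notin ksets n k -> kset_vec F k T = 0.
Proof.
move=> nkT; apply/rowP=> j; rewrite !mxE; case: eqP => // eqT.
by rewrite -eqT enum_valP in nkT.
Qed.

Lemma kset_vecM (F : fieldType) n k (s : {perm 'Z_n}) (T : {set 'Z_n}) :
  kset_vec F k T *m kset_mx F k s = kset_vec F k (s @: T).
Proof.
have [kT|nkT] := boolP (T \in ksets n k); last first.
  by rewrite !kset_vec_out ?imset_kset // mul0mx.
rewrite mulmx_sum_row (bigD1 (enum_rank_in kT T)) //= big1 => [|i neq].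
  by rewrite addr0 rowK !mxE enum_rankK_in // eqxx scale1r.
rewrite mxE; case: eqP => [eqT|_]; last by rewrite scale0r.
by case/eqP: neq; apply: enum_val_inj; rewrite enum_rankK_in.
Qed.

Lemma kset_mx_repr (F : fieldType) n k :
  mx_repr [set: {perm 'Z_n}] (@kset_mx F n k).
Proof.
split=> [|s t _ _]; apply/row_matrixP=> i; rewrite ?row_mul !rowK.
  apply/rowP=> j; rewrite !mxE (eq_imset _ (@perm1 _)) imset_id.
  by rewrite (inj_eq enum_val_inj) eq_sym.
rewrite kset_vecM -imset_comp.
by congr kset_vec; apply: eq_imset => x; rewrite permM.
Qed.

Canonical kset_repr (F : fieldType) n k := MxRepresentation (@kset_mx_repr F n k).

(* Specht module of shape (n - l, l), realised in the permutation module on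
   tabloids.  Positions 0, ..., n-l-1 form the first row of the diagram and
   n-l, ..., n-1 the second one; a tableau assigns an entry to each position,
   and a tabloid is identified with the set of entries of its second row. *)
Section Specht.
Variables (F : fieldType) (n l : nat).
Implicit Types s t : {perm 'Z_n}.

Definition box_col (p : 'Z_n) : nat :=
  if (p < n - l)%N then p : nat else (p - (n - l))%N.

Definition second_row t : {set 'Z_n} := [set t p | p : 'Z_n & (n - l <= p)%N].

Definition col_stab t : {set {perm 'Z_n}} :=
  [set s : {perm 'Z_n} | [forall p, box_col (t^-1%g (s (t p))) == box_col p]].

Definition polytabloid t : 'rV[F]_#|ksets n l| :=
  \sum_(s in col_stab t) (-1) ^+ s *: kset_vec F l (s @: second_row t).

Definition specht : 'M[F]_#|ksets n l| :=
  (\sum_(t : {perm 'Z_n}) <<polytabloid t>>)%MS.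

Lemma polytabloidM (g : {perm 'Z_n}) t :
  polytabloid t *m kset_mx F l g = polytabloid (t * g)%g.
Proof.
rewrite mulmx_suml [RHS](reindex_inj (conjg_inj g)) /=.
apply: eq_big => [s|s _].
  rewrite !inE; apply: eq_forallb => p; congr (box_col _ == _).
  by rewrite conjgE invMg !permM !permK.
rewrite -scalemxAl kset_vecM odd_permJ; congr (_ *: kset_vec _ _ _).
rewrite -!imset_comp; apply: eq_imset => p /=.
by rewrite conjgE !permM permK.
Qed.

Lemma specht_mod : mxmodule (kset_repr F n l) specht.
Proof.
apply/mxmoduleP=> g _.
rewrite sumsmxMr; apply/sumsmx_subP=> t _.
rewrite (eqmxMr _ (genmxE _)) polytabloidM.
by rewrite (sumsmx_sup (t * g)%g) // genmxE.
Qed.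

End Specht.

(* V_k is the direct sum of U 0, ..., U k with U i isomorphic to the Specht
   module of shape (n - i, i). *)
Definition specht_decomposition (F : fieldType) n k
    (U : nat -> 'M[F]_#|ksets n k|) : Prop :=
  [/\ mxdirect (\sum_(i < k.+1) U i),
      (\sum_(i < k.+1) U i :=: 1%:M)%MS
    & forall i, (i <= k)%N ->
      exists modU : mxmodule (kset_repr F n k) (U i),
        mx_rsim (submod_repr modU) (submod_repr (specht_mod F n i))].

(* c is the scalar by which the wreath matrix acts on E_l = Phi (U_l). *)
Definition is_lambda (F : fieldType) n k l (c : F) : Prop :=
  exists2 U : nat -> 'M[F]_#|ksets n k|, specht_decomposition U &
    let E := U l *m Phi_mx F n k in E *m wreath_mx F n k = c *: E.

(* Main.v *)
Require Import Defs.
From mathcomp Require Import all_boot all_order all_fingroup all_algebra all_character.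
From mathcomp Require Import complex reals.
From mathcomp Require Import ring zify.
Set Implicit Arguments.
Unset Strict Implicit.
Unset Printing Implicit Defensive.
Import Order.TTheory GRing.Theory Num.Theory.
Local Open Scope ring_scope.

(** Let Phi be the inclusion matrix of k-sets in wreaths.  The wreath matrix is
    Phi^T Phi, so whenever N = Phi Phi^T acts on U_l by a nonzero scalar mu, the
    wreath matrix acts on E_l = Phi(U_l), which is then nonzero, by the same mu.
    The matrix N is indexed by k-sets and commutes with the symmetric group.

    The Specht module of shape (n - l, l) is generated by a single polytabloid,
    attached to l disjoint pairs (a_i, b_i).  It changes sign when a_i and b_i are
    exchanged and is fixed when two points outside the pairs are exchanged.  Its
    image in V_k has these symmetries too, and up to a factor there is only one
    such vector ([pair_alternating_unique]): its coordinate at T is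
      w(T) = prod_i ([b_i in T] - [a_i in T]).
    Hence w is an eigenvector of N ([gram_eigenvector]), and as its translates
    span U_l ([rsim_generator]) its eigenvalue is mu.  This replaces both Schur's
    lemma and the irreducibility of Specht modules.

    The eigenvalue is read off at the coordinate of one k-set B0 that contains all
    the b_i and none of the a_i.  A wreath consists of the images under a
    permutation of the n cyclic arcs of length k, and it comes from exactly 2 n
    permutations, because the permutations preserving the set of arcs form a
    dihedral group ([card_wreath_fibre]).  Hence 2 mu is the sum of w(p(J)) over all arcs J
    and all permutations p that send a fixed arc J0 onto B0.  Expanding w as a sum
    over subsets of the pairs and counting permutations ([card_perm_placing]), the
    contribution of J depends only on d = |J - J0|; it is
      sum_q (-1)^q C(l, q) (k - d)^_(l - q) (k - l + q)! d^_q (n - k - q)!.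
    Each d with 0 < d < k occurs for two arcs, d = 0 for one, and d = k for the
    n - 2 k + 1 others.  Since the sum over d of C(k - d, l - q) C(d, q) is
    C(k + 1, l + 1) for every q, the total is (n - k - l)! Q(n) for an explicit
    polynomial Q ([eigen_poly], [sum_zonal_distance]).

    The coefficient of Q in degree l is k! (2 (k + 1) / (l + 1) - 1), so Q is not
    zero.  For each n > 2 k coprime to k with Q(n) != 0, the above gives
    2 P(n) = Q(n); the numbers n = j k + 1 then force 2 P = Q.  It remains to find
    the roots of Q.  At l all the summands over q have the same sign and their sum
    has a closed form, which cancels the other terms.  At 2 k the summands of
    indices q and l - q are opposite when l is odd, and the other terms cancel. *)

(** * The eigenvalue polynomial and its roots *)

(** Choosing a + b + 1 elements of a (k + 1)-set, split according to the
    position d of the (b + 1)-st smallest one. *)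
Lemma sum_bin_convol k a b :
  (\sum_(d < k.+1) 'C(k - d, a) * 'C(d, b) = 'C(k.+1, (a + b).+1))%N.
Proof.
elim: k a b => [|k IHk] [|a] b.
- by rewrite big_ord1 /= bin0 mul1n add0n binS bin0n addnC; case: b.
- by rewrite big_ord1 sub0n bin0n mul0n bin_small.
- under eq_bigr do rewrite bin0 mul1n.
  have IHk0 : (\sum_(d < k.+1) 'C(d, b) = 'C(k.+1, b.+1))%N.
    by rewrite -[b in RHS]add0n -IHk; under [RHS]eq_bigr do rewrite bin0 mul1n.
  by rewrite big_ord_recr /= IHk0 add0n binS.
rewrite big_ord_recr /= subnn bin0n mul0n addn0.
under eq_bigr => d _ do rewrite subSn -1?ltnS // binS mulnDl.
by rewrite big_split /= !IHk addSn [RHS]binS addnC addnC.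
Qed.

Section Polynomial.
Variable F : numFieldType.

(** Falling factorials as polynomials: at a natural number n >= c the value is the
    falling factorial of n - c with r factors. *)
Definition falling_poly (c r : nat) : {poly F} :=
  \prod_(i < r) ('X - (c + i)%:R%:P).

Lemma horner_falling_poly c r n : (c + r <= n)%N ->
  (falling_poly c r).[n%:R] * (n - c - r)`!%:R = (n - c)`!%:R.
Proof.
elim: r => [|r IHr] le_n; first by rewrite /falling_poly big_ord0 hornerC mul1r subn0.
rewrite /falling_poly big_ord_recr /= hornerM hornerXsubC -natrB; last lia.
rewrite -IHr; last lia.
rewrite -mulrA -natrM; congr (_ * _%:R).
have -> : (n - c - r = (n - c - r.+1).+1)%N by lia.
by rewrite factS; congr (_ * _)%N; lia.
Qed.

Lemma size_falling_poly c r : size (falling_poly c r) = r.+1.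
Proof.
rewrite /falling_poly -(big_map (fun i : 'I_r => (c + i)%:R) xpredT (fun x => 'X - x%:P)).
by rewrite size_prod_XsubC size_map /index_enum -enumT size_enum_ord.
Qed.

Lemma coef_falling_poly c r : (falling_poly c r)`_r = 1.
Proof.
have /monicP : falling_poly c r \is monic by rewrite monic_prod_XsubC.
by rewrite lead_coefE size_falling_poly.
Qed.

(** The point of evaluation is at most k, so that no factor is positive; the factor k clears the denominator of (k - 1)! = k! / k. *)
Lemma horner_falling_poly_neg k l r : (r <= l <= k)%N ->
  k%:R * ((k - r)`!%:R * (falling_poly (k + (l - r)) r).[l%:R])
    = (-1) ^+ r * ((k - r) * k`!)%:R.
Proof.
move=> /andP[le_rl le_lk].
have -> : (falling_poly (k + (l - r)) r).[l%:R] = (-1) ^+ r * \prod_(i < r) (k - r + i)%:R.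
  rewrite /falling_poly horner_prod -[X in (-1) ^+ X](card_ord r) -prodrN.
  apply: eq_bigr => i _; rewrite hornerXsubC -opprB -natrB; last by lia.
  by congr (- _%:R); lia.
set Q := \prod_(i < r) _; transitivity ((-1) ^+ r * (k%:R * ((k - r)`!%:R * Q))); first by ring.
congr (_ * _); rewrite {}/Q.
rewrite -natr_prod -!natrM; congr _%:R.
have ek : k = (k - r + r)%N by lia.
move: (k - r)%N ek => a ->; elim: r {le_rl} => [|r IHr]; first by rewrite big_ord0 addn0 muln1.
rewrite big_ord_recr /= addnS factS.
set Q := (\prod_(i < r) _)%N in IHr *.
transitivity ((a + r).+1 * ((a + r) * (a`! * Q)))%N; first by ring.
by rewrite IHr; ring.
Qed.

(** Twice the polynomial P of the theorem, which keeps the coefficients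
    integral.  The three terms come, in order, from twice the sum over distances
    0, ..., k, from the distance 0 counted once too often, and from the arcs at
    distance k not counted yet. *)
Definition eigen_poly (k l : nat) : {poly F} :=
  (2 * (l`! * 'C(k.+1, l.+1)))%:R *:
    (\sum_(q < l.+1) ((-1) ^+ q * (k - (l - q))`!%:R) *: falling_poly (k + q) (l - q))
  - k`!%:R *: falling_poly k l
  + ((-1) ^+ l * (k`! * k ^_ l)%:R) *: ('X - (2 * k).+1%:R%:P).

Lemma fact_binS k l : (l.+1 * (l`! * 'C(k.+1, l.+1)) = k.+1 * k ^_ l)%N.
Proof. by rewrite mulnA -factS mulnC bin_ffact ffactSS. Qed.

(** In degree l only the q = 0 summand and the second term contribute; the linear
    factor of the third term has degree 1 < l. *)
Lemma eigen_poly_neq0 k l : (2 <= l <= k)%N -> eigen_poly k l != 0.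
Proof.
move=> /andP[le2l le_lk]; apply/eqP => /(congr1 (fun p : {poly F} => p`_l)).
rewrite coef0 /eigen_poly coefD coefB !coefZ coef_sum.
rewrite (bigD1 ord0) //= big1 ?addr0 => [|q nz_q]; last first.
  rewrite coefZ (nth_default _ (_ : size _ <= l)%N) ?mulr0 //.
  by rewrite size_falling_poly; move: nz_q; rewrite -val_eqE /=; have := ltn_ord q; lia.
rewrite (nth_default _ (_ : size ('X - _)%R <= l)%N) ?size_XsubC // mulr0 addr0.
rewrite coefZ subn0 addn0 !coef_falling_poly expr0 mul1r !mulr1 -natrM.
apply/eqP; rewrite subr_eq0 eqr_nat; apply/eqP => eq_k.
have := congr1 (muln l.+1) eq_k.
have -> : (l.+1 * (2 * (l`! * 'C(k.+1, l.+1)) * (k - l)`!)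
   = 2 * ((l.+1 * (l`! * 'C(k.+1, l.+1))) * (k - l)`!))%N by lia.
rewrite fact_binS -mulnA ffact_fact // mulnA => /eqP.
by rewrite eqn_pmul2r ?fact_gt0 //; lia.
Qed.

Lemma eigen_poly_root_l k l : (2 <= l <= k)%N -> root (eigen_poly k l) l%:R.
Proof.
move=> /andP[le2l le_lk].
have nz_k : k%:R != 0 :> F by rewrite pnatr_eq0; lia.
rewrite /root -(mulrI_eq0 _ (mulfI nz_k)); apply/eqP.
rewrite /eigen_poly !hornerD hornerN !hornerZ horner_sum hornerXsubC mulrDr mulrBr.
set c := (2 * _)%N.
have -> : k%:R * (c%:R * (\sum_(q < l.+1)
    (((-1) ^+ q * (k - (l - q))`!%:R) *: falling_poly (k + q) (l - q)).[l%:R]))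
  = (-1) ^+ l * (l`! * 'C(k.+1, l.+1) * (l.+1 * (2 * k - l)) * k`!)%:R.
  (* Up to a common factor the summands are k - l, ..., k. *)
  have sumE : (2 * \sum_(q < l.+1) (k - (l - q)) = l.+1 * (2 * k - l))%N.
    rewrite (reindex_inj rev_ord_inj) /=.
    under eq_bigr => q _ do rewrite subSS subKn ?leq_ord //.
    elim: l le_lk {le2l c} => [|j IHj] le_jk; first by rewrite big_ord1 /=; lia.
    rewrite big_ord_recr /= mulnDr IHj; first nia.
    by lia.
  rewrite -sumE -[X in (X * _)%:R]mulnCA mulnA -/c -mulnA natrM mulrCA [RHS]mulrCA.
  congr (_ * _); rewrite big_distrl /= natr_sum !mulr_sumr.
  apply: eq_bigr => q _; rewrite hornerZ -[in LHS]mulrA mulrCA.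
  have := @horner_falling_poly_neg k l (l - q).
  have le_q := leq_ord q; rewrite subKn // => -> ; last lia.
  rewrite mulrA -exprD; congr (_ * _).
  by rewrite subnKC.
have -> : k%:R * (k`!%:R * (falling_poly k l).[l%:R])
    = (-1) ^+ l * (k ^_ l * ((k - l) * k`!))%:R.
  have := @horner_falling_poly_neg k l l; rewrite subnn addn0 leqnn => /(_ le_lk) e.
  transitivity ((k ^_ l)%:R * (k%:R * ((k - l)`!%:R * (falling_poly k l).[l%:R]))).
    by rewrite -[in LHS](ffact_fact le_lk) natrM; ring.
  by rewrite e; ring.
have eC := fact_binS k l; rewrite -(subnK le_lk) in eC *.
move: (k - l)%N eC => m eC.
have -> : (l`! * 'C((m + l).+1, l.+1) * (l.+1 * (2 * (m + l) - l))
           = (m + l).+1 * (m + l) ^_ l * (2 * m + l))%N by rewrite -eC; lia.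
rewrite addnK -[(m + l).+1]addn1 -[(2 * _).+1]addn1; move: (m + l)`! ((m + l) ^_ l) => K D.
rewrite !(natrM, natrD); move: ((-1) ^+ l) => e.
by ring.
Qed.

(** For n = 2 k the complement of a k-set is again a k-set, and the summands
    of indices q and l - q become equal up to the sign (-1)^l. *)
Lemma eigen_poly_root_2k k l : (2 <= l <= k)%N -> odd l -> root (eigen_poly k l) (2 * k)%:R.
Proof.
move=> /andP[le2l le_lk] odd_l.
rewrite /root /eigen_poly !hornerD hornerN !hornerZ horner_sum hornerXsubC.
set S := \sum_(q < _) _.
have nzf m : m`!%:R != 0 :> F by rewrite pnatr_eq0 -lt0n fact_gt0.
have S0 : S = 0.
  apply: (mulIf (nzf (k - l)%N)); rewrite mul0r.
  have SE : S * (k - l)`!%:R = \sum_(q < l.+1) (-1) ^+ q * ((k - (l - q))`! * (k - q)`!)%:R.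
    rewrite mulr_suml; apply: eq_bigr => q _; have le_q := leq_ord q.
    rewrite hornerZ [in RHS]natrM -!mulrA; congr (_ * (_ * _)).
    have -> : (k - l = 2 * k - (k + q) - (l - q))%N by lia.
    by rewrite horner_falling_poly; [congr (_`!)%:R|]; lia.
  (* The substitution q -> l - q changes the sign of the sum. *)
  have : S * (k - l)`!%:R = - (S * (k - l)`!%:R).
    rewrite {1}SE (reindex_inj rev_ord_inj) /= SE -sumrN; apply: eq_bigr => q _.
    have le_q := leq_ord q; rewrite subSS subKn // mulnC.
    by rewrite -signr_odd oddB // odd_l /= signrN signr_odd mulNr.
  by move/eqP; rewrite -addr_eq0 -mulr2n mulrn_eq0 /= => /eqP.
rewrite S0 mulr0 sub0r.
have -> : k`!%:R * (falling_poly k l).[(2 * k)%:R] = (k`! * k ^_ l)%:R.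
  rewrite [in RHS]natrM; congr (_ * _); apply: (mulIf (nzf (k - l)%N)).
  have {1}-> : (k - l = 2 * k - k - l)%N by lia.
  rewrite horner_falling_poly; last by lia.
  by rewrite -natrM ffact_fact //; congr (_`!)%:R; lia.
by rewrite -signr_odd odd_l expr1 mulN1r -opprB -natrB // subSnn mulrNN mulr1 addNr.
Qed.

(** On a cycle of length n > 2 k each distance 0 < d < k is attained twice,
    0 once, and all the remaining points are at distance k or more. *)
Lemma sum_cyclic_distance (f : nat -> F) k n : (2 * k < n)%N ->
  \sum_(x < n) f (minn k (minn x (n - x))) =
    2 * \sum_(d < k.+1) f d - f 0 + (n%:R - (2 * k).+1%:R) * f k.
Proof.
move=> lt_2k_n; pose g x := f (minn k (minn x (n - x))).
rewrite -(big_mkord xpredT g) (@big_cat_nat _ _ _ k.+1) //=; last by lia.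
rewrite (@big_cat_nat _ _ _ (n - k) k.+1) //=; try lia.
have -> : \sum_(0 <= x < k.+1) g x = \sum_(d < k.+1) f d.
  rewrite big_mkord; apply: eq_bigr => d _; congr f.
  by have := ltn_ord d; lia.
have -> : \sum_(k.+1 <= x < n - k) g x = (n%:R - (2 * k).+1%:R) * f k.
  rewrite -natrB // mulr_natl.
  have -> : (n - (2 * k).+1 = n - k - k.+1)%N by lia.
  rewrite -sumr_const_nat; apply: eq_big_nat => x le_x.
  by rewrite /g (_ : minn k _ = k) //; lia.
have -> : \sum_(n - k <= x < n) g x = \sum_(d < k.+1) f d - f 0.
  rewrite big_ord_recl [f 0 + _]addrC addrK /= -{1}[(n - k)%N]add0n big_addn.
  have -> : (n - (n - k) = k)%N by lia.
  rewrite big_mkord (reindex_inj rev_ord_inj) /=; apply: eq_bigr => d _.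
  by congr f; have := ltn_ord d; rewrite /bump /=; lia.
ring.
Qed.

(** The contribution to twice the eigenvalue of one arc J meeting the fixed arc
    J0 in k - d points; q counts the pairs whose a-point is sent into J.  It is an
    unnormalised zonal spherical function of the Johnson scheme. *)
Definition zonal_sum (n k l d : nat) : F :=
  \sum_(q < l.+1) (-1) ^+ q *
    ('C(l, q) * ((k - d) ^_ (l - q) * (k - (l - q))`! * (d ^_ q * (n - k - q)`!)))%:R.

(** After the summation over d the falling factorials become
    (l - q)! q! C(k + 1, l + 1), and the factor C(l, q) turns this into
    l! C(k + 1, l + 1), whatever q is. *)
Lemma sum_zonal_sum n k l : (l <= k)%N ->
  \sum_(d < k.+1) zonal_sum n k l d =
    (l`! * 'C(k.+1, l.+1))%:R *
    \sum_(q < l.+1) (-1) ^+ q * ((k - (l - q))`! * (n - k - q)`!)%:R.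
Proof.
move=> le_lk; rewrite exchange_big mulr_sumr /=; apply: eq_bigr => q _.
have le_q := leq_ord q.
rewrite -mulr_sumr mulrCA; congr (_ * _); rewrite -natr_sum -natrM; congr _%:R.
have := sum_bin_convol k (l - q) q; rewrite subnK // => <-.
rewrite big_distrr big_distrl /=; apply: eq_bigr => d _.
by rewrite -!bin_ffact -(bin_fact le_q); ring.
Qed.

Lemma sum_zonal_distance n k l : (l <= k)%N -> (2 * k < n)%N ->
  \sum_(x < n) zonal_sum n k l (minn k (minn x (n - x)))
    = (n - k - l)`!%:R * (eigen_poly k l).[n%:R].
Proof.
move=> le_lk lt_2k_n; rewrite sum_cyclic_distance // sum_zonal_sum //.
have -> : zonal_sum n k l 0 = (k`! * (n - k)`!)%:R.
  rewrite /zonal_sum (bigD1 ord0) //= big1 ?addr0 => [|q nz_q].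
    by rewrite expr0 bin0 !subn0 ffactn0 !mul1r !mul1n ffact_fact.
  by rewrite [(0 ^_ q)%N]ffact_small ?mul0n ?muln0 ?mulr0 // lt0n.
have -> : zonal_sum n k l k = (-1) ^+ l * (k`! * k ^_ l * (n - k - l)`!)%:R.
  rewrite /zonal_sum (bigD1 ord_max) //= big1 ?addr0 => [|q nz_q].
    by rewrite binn !subnn ffactn0 subn0 !mul1n mulnA.
  rewrite subnn [(0 ^_ _)%N]ffact_small ?mul0n ?muln0 ?mulr0 // subn_gt0.
  by move: nz_q; rewrite -val_eqE /=; have := ltn_ord q; lia.
rewrite /eigen_poly !hornerD hornerN !hornerZ horner_sum hornerXsubC.
rewrite mulrDr mulrBr; congr (_ - _ + _).
- set C := (l`! * _)%N; rewrite (natrM _ 2 C) [RHS]mulrCA -mulrA.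
  congr (_ * (_ * _)); rewrite {C}.
  rewrite mulr_sumr; apply: eq_bigr => q _; have le_q := leq_ord q.
  rewrite hornerZ natrM -subnDA -(@horner_falling_poly (k + q) (l - q) n); last by lia.
  by rewrite (_ : n - (k + q) - (l - q) = n - k - l)%N; [ring | lia].
- by rewrite [in LHS]natrM -(@horner_falling_poly k l n); [ring | lia].
by rewrite [in LHS]natrM; ring.
Qed.

End Polynomial.

(** * Counting permutations with prescribed images *)

Section CountPerm.
Variable T : finType.
Implicit Types (S : {set {perm T}}) (Z A B : {set T}).

(** Membership of s in S depends only on the values of s on Z; it is enough to
    require this for changes of s by transpositions of points outside Z. *)
Definition determined_on Z S :=
  forall s y y', s \in S -> y \notin Z -> y' \notin Z -> (tperm y y' * s)%g \in S.

(** By double counting: moving z within the complement of Z does not change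
    the number of s in S with s z in A, while each s in S sends exactly u of the
    points outside Z into A. *)
Lemma card_perm_extend1 S Z A u z :
  determined_on Z S -> (forall s, s \in S -> #|A :\: s @: Z| = u) -> z \notin Z ->
  (#|[set s in S | s z \in A]| * (#|T| - #|Z|) = #|S| * u)%N.
Proof.
move=> detS freeA nZz.
transitivity (\sum_(y in ~: Z) #|[set s in S | s y \in A]|)%N.
  rewrite (_ : #|T| - #|Z| = #|~: Z|)%N; last by rewrite [RHS]cardsCs setCK.
  rewrite [RHS](eq_bigr (fun=> #|[set s in S | s z \in A]|)).
    by rewrite sum_nat_const mulnC.
  move=> y; rewrite inE => nZy.
  have injt := can_inj (mulKg (tperm z y)).
  rewrite -(card_imset _ injt); apply: eq_card => s; apply/imsetP/idP.
    case=> r; rewrite inE => /andP[Sr Ary] ->.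
    by rewrite inE detS //= permM tpermL.
  rewrite inE => /andP[Ss As]; exists (tperm z y * s)%g.
    by rewrite inE detS //= permM tpermR.
  by rewrite mulgA tperm2 mul1g.
under eq_bigr do rewrite -sum1_card.
under eq_bigr => y _.
  rewrite (eq_bigl (fun s => (s \in S) && (s y \in A))); last by move=> s; rewrite inE.
  over.
rewrite (exchange_big_dep (mem S)) /=; last by move=> y s _ /andP[].
rewrite -sum_nat_const; apply: eq_bigr => s Ss; rewrite -(freeA s Ss).
rewrite sum1dep_card -(card_imset _ (@perm_inj _ s)); apply: eq_card => t.
apply/imsetP/idP => [[y]|].
  rewrite !inE => /and3P[nZy _ Asy] ->.
  by rewrite Asy mem_imset ?nZy //; apply: perm_inj.
rewrite inE => /andP[nsZt At]; exists (s^-1%g t); last by rewrite permKV.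
rewrite !inE permKV At Ss !andbT; apply: contra nsZt => Zt.
by apply/imsetP; exists (s^-1%g t) => //; rewrite permKV.
Qed.

(** Adding the points of B to Z one at a time multiplies the number of
    permutations by the ratios u / (N - |Z|), (u - 1) / (N - |Z| - 1), and so on. *)
Lemma card_perm_extend S Z A B u :
  determined_on Z S -> (forall s, s \in S -> #|A :\: s @: Z| = u) ->
  [disjoint B & Z] ->
  (#|[set s in S | s @: B \subset A]| * (#|T| - #|Z|) ^_ #|B| = #|S| * u ^_ #|B|)%N.
Proof.
move Db: #|B| => b; elim: b => [|b IHb] in S Z B u Db *.
  move=> _ _ _; rewrite !ffactn0 !muln1; apply: eq_card => s.
  by rewrite inE (cards0_eq Db) imset0 sub0set andbT.
move=> detS freeA disBZ.
have /card_gt0P[z Bz] : (0 < #|B|)%N by rewrite Db.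
have nZz : z \notin Z by rewrite (disjointFr disBZ Bz).
have DbD : #|B :\ z| = b by have := cardsD1 z B; rewrite Bz Db => -[].
pose S1 := [set s in S | s z \in A].
have det1 : determined_on (z |: Z) S1.
  move=> s y y'; rewrite !inE !negb_or => /andP[Ss Asz] /andP[zy nZy] /andP[zy' nZy'].
  by rewrite detS //= permM tpermD // eq_sym.
have free1 s : s \in S1 -> #|A :\: s @: (z |: Z)| = u.-1.
  rewrite inE => /andP[Ss Asz]; rewrite -(freeA s Ss).
  rewrite imsetU1 setUC -setDDl (cardsD1 (s z) (A :\: s @: Z)) !inE Asz.
  by rewrite mem_imset ?(negbTE nZz) //; apply: perm_inj.
have dis1 : [disjoint B :\ z & z |: Z].
  rewrite disjoints_subset; apply/subsetP => y; rewrite !inE negb_or => /andP[-> By].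
  by rewrite (disjointFr disBZ By).
have /esym := IHb _ _ _ _ DbD det1 free1 dis1.
rewrite !ffactnS cardsU1 nZz.
have -> : #|[set s in S1 | s @: (B :\ z) \subset A]| = #|[set s in S | s @: B \subset A]|.
  apply: eq_card => s; rewrite !inE -andbA; congr (_ && _).
  by rewrite -{2}(setD1K Bz) imsetU1 subUset sub1set.
have e := card_perm_extend1 detS freeA nZz.
rewrite (_ : #|T| - (_ + _) = (#|T| - #|Z|).-1)%N; last by rewrite add1n; lia.
by move=> e1; rewrite mulnCA -e1 mulnA [(_ * #|S1|)%N]mulnC e mulnA.
Qed.

(** The points of B are placed in the intersection of J0 and J, then the rest of T0
    in what is left of J0, and finally those of A in the difference of J and J0. *)
Lemma card_perm_placing (k : nat) (T0 J0 J B A : {set T}) :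
  #|T0| = k -> #|J0| = k -> B \subset T0 -> [disjoint A & T0] ->
  #|[set s : {perm T} | [&& s @: T0 == J0, s @: B \subset J & s @: A \subset J]]| =
  (#|J0 :&: J| ^_ #|B| * (k - #|B|)`! * (#|J :\: J0| ^_ #|A| * (#|T| - k - #|A|)`!))%N.
Proof.
move=> cT0 cJ0 sBT dAT.
pose S1 := [set s in [set: {perm T}] | s @: B \subset J0 :&: J].
pose S2 := [set s in S1 | s @: (T0 :\: B) \subset J0].
pose S3 := [set s in S2 | s @: A \subset J :\: J0].
have -> : [set s : {perm T} | [&& s @: T0 == J0, s @: B \subset J & s @: A \subset J]] = S3.
  apply/setP => s; rewrite !inE subsetI.
  have -> : (s @: T0 == J0) = (s @: T0 \subset J0).
    by rewrite eqEcard card_imset ?cT0 ?cJ0 ?leqnn ?andbT //; apply: perm_inj.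
  have -> : (s @: T0 \subset J0) = (s @: B \subset J0) && (s @: (T0 :\: B) \subset J0).
    by rewrite -subUset -imsetU -{1}(setID T0 B) (setIidPr sBT).
  case: (boolP (s @: B \subset J0)) => //= sB0.
  case: (s @: B \subset J) => //=; last by rewrite andbF.
  case: (boolP (s @: (T0 :\: B) \subset J0)) => //= sTB0.
  rewrite subsetD; case: (s @: A \subset J) => //=; symmetry.
  have sT0 : s @: T0 = J0.
    apply/eqP; rewrite eqEcard card_imset ?cT0 ?cJ0 ?leqnn ?andbT //; last exact: perm_inj.
    by rewrite -(setID T0 B) (setIidPr sBT) imsetU subUset sB0.
  by rewrite -sT0 (imset_disjoint (@perm_inj _ s)).
have le_b : (#|B| <= k)%N by rewrite -cT0 subset_leq_card.
have le_k : (k <= #|T|)%N by rewrite -cT0 max_card.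
have le_a : (#|A| <= #|T| - k)%N.
  have := subset_leq_card (subsetT (A :|: T0)).
  rewrite cardsU disjoint_setI0 // cards0 cardsT cT0; lia.
have det0 : determined_on set0 [set: {perm T}] by move=> *; rewrite inE.
have det1 : determined_on B S1.
  move=> s y y'; rewrite !inE => sB nBy nBy'.
  apply/subsetP => _ /imsetP[x Bx ->]; rewrite permM tpermD.
  - by apply: (subsetP sB); apply: imset_f.
  - by apply: contraNneq nBy => ->.
  - by apply: contraNneq nBy' => ->.
have det2 : determined_on T0 S2.
  move=> s y y'; rewrite !inE => /andP[sB sTB] nTy nTy'.
  have fix_t x : x \in T0 -> tperm y y' x = x.
    by move=> Tx; rewrite tpermD //; [apply: contraNneq nTy => ->|apply: contraNneq nTy' => ->].
  apply/andP; split; apply/subsetP => _ /imsetP[x Bx ->]; rewrite permM fix_t.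
  - by apply: (subsetP sB); apply: imset_f.
  - exact: (subsetP sBT).
  - by apply: (subsetP sTB); apply: imset_f.
  - by case/setDP: Bx.
have card1 : (#|S1| * #|T| ^_ #|B| = #|T|`! * #|J0 :&: J| ^_ #|B|)%N.
  have := card_perm_extend (B := B) (A := J0 :&: J) (u := #|J0 :&: J|) det0.
  rewrite -/S1 cards0 subn0.
  have -> : #|[set: {perm T}]| = #|T|`!.
    rewrite -[#|T|]cardsT -card_perm; apply: eq_card => s.
    by rewrite !inE; apply/esym/subsetP => x; rewrite inE.
  apply.
    by move=> s _; rewrite imset0 setD0.
  by rewrite disjoint_sym disjoints_subset sub0set.
have card2 : (#|S2| * (#|T| - #|B|) ^_ (k - #|B|) = #|S1| * (k - #|B|) ^_ (k - #|B|))%N.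
  have cTB : #|T0 :\: B| = (k - #|B|)%N by rewrite cardsD (setIidPr sBT) cT0.
  rewrite -cTB; apply: (card_perm_extend det1); last by rewrite disjoints_subset subsetDr.
  move=> s; rewrite !inE subsetI /= => /andP[sB _].
  by rewrite cardsD (setIidPr sB) card_imset ?cJ0 ?cTB //; apply: perm_inj.
have card3 : (#|S3| * (#|T| - k) ^_ #|A| = #|S2| * #|J :\: J0| ^_ #|A|)%N.
  rewrite -cT0; apply: (card_perm_extend det2) => // s; rewrite !inE /= => /andP[sB sTB].
  congr #|pred_of_set _|; apply/setDidPl; rewrite disjoint_sym disjoints_subset.
  apply/subsetP => _ /imsetP[x Tx ->]; rewrite !inE negb_and negbK; apply/orP; left.
  case: (boolP (x \in B)) => Bx.
    by have /subsetP/(_ (s x)) := sB; rewrite !inE imset_f // => /(_ isT) /andP[].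
  by apply: (subsetP sTB); apply: imset_f; rewrite !inE Bx.
have f1 := ffact_fact (leq_trans le_b le_k).
have f2 := ffact_fact (leq_sub2r #|B| le_k).
rewrite (_ : #|T| - #|B| - (k - #|B|) = #|T| - k)%N in f2; last lia.
have f3 := ffact_fact le_a.
have pos m r : (r <= m)%N -> (0 < m ^_ r)%N by rewrite ffact_gt0.
have eS1 : #|S1| = ((#|T| - #|B|)`! * #|J0 :&: J| ^_ #|B|)%N.
  apply/eqP; rewrite -(eqn_pmul2r (pos _ _ (leq_trans le_b le_k))) card1 -f1.
  by apply/eqP; ring.
have eS2 : #|S2| = ((#|T| - k)`! * (k - #|B|)`! * #|J0 :&: J| ^_ #|B|)%N.
  apply/eqP; rewrite -(eqn_pmul2r (pos _ _ (leq_sub2r #|B| le_k))) card2 eS1 -f2 ffactnn.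
  by apply/eqP; ring.
apply/eqP; rewrite -(eqn_pmul2r (pos _ _ le_a)) card3 eS2 -f3.
by apply/eqP; ring.
Qed.

End CountPerm.

(** * Cyclic arcs, wreaths and the dihedral group *)

Lemma card_ord_interval N a b : (b <= N)%N -> #|[set i : 'I_N | (a <= i < b)%N]| = (b - a)%N.
Proof.
move=> le_bN; rewrite -sum1dep_card -(big_mkord (fun i => a <= i < b)%N (fun=> 1%N)).
have [le_ab|lt_ba] := leqP a b; last first.
  by rewrite big1 => [|i]; [|case/andP]; lia.
rewrite -big_nat_widen //.
rewrite (@big_cat_nat _ _ _ a) //= big_nat_cond big1; last by move=> i; lia.
rewrite add0n big_nat_cond (eq_bigl (fun i => a <= i < b)%N) => [|i].
  by rewrite -big_nat sum_nat_const_nat muln1.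
by lia.
Qed.

Section Arcs.
Variables (n k : nat).
Hypothesis n_gt1 : (1 < n)%N.
Implicit Types x y z : 'Z_n.

Lemma ltn_Zp x : (x < n)%N.
Proof. by rewrite -[X in (_ < X)%N](Zp_cast n_gt1) ltn_ord. Qed.

Lemma card_Zmod : #|'Z_n| = n.
Proof. by rewrite card_ord Zp_cast. Qed.

Lemma val_subZ x y : ((x - y)%R = (if y <= x then x - y else n + x - y) :> nat)%N.
Proof.
rewrite /=; have := ltn_Zp x; have := ltn_Zp y.
move: (nat_of_ord x) (nat_of_ord y) => u v; rewrite Zp_cast // modnDmr => lt_vn lt_un.
case: leqP => le_vu; last by rewrite modn_small; lia.
by rewrite (_ : u + (n - v) = u - v + n)%N ?modnDr ?modn_small //; lia.
Qed.

Lemma val_addZ x y : ((x + y)%R = (if x + y < n then x + y else x + y - n) :> nat)%N.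
Proof.
rewrite /=; have := ltn_Zp x; have := ltn_Zp y.
move: (nat_of_ord x) (nat_of_ord y) => u v; rewrite Zp_cast // => lt_vn lt_un.
case: ltnP => le_n; first by rewrite modn_small.
by rewrite -[in LHS](subnK le_n) modnDr modn_small //; lia.
Qed.

Lemma val_natZ (m : nat) : (m < n)%N -> (m%:R : 'Z_n) = m :> nat.
Proof. by move=> lt_mn; rewrite val_Zp_nat // modn_small. Qed.

(** The k cyclically consecutive residues from x on. *)
Definition arcZ x : {set 'Z_n} := [set y : 'Z_n | ((y - x)%R < k)%N].

Lemma mem_arcD z x y : (z + y \in arcZ (z + x)) = (y \in arcZ x).
Proof. by rewrite !inE opprD addrACA subrr add0r. Qed.

Lemma arcD_imset z x : [set z + y | y in arcZ x] = arcZ (z + x).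
Proof.
apply/setP=> y; apply/imsetP/idP => [[t xt ->]|zxy]; first by rewrite mem_arcD.
by exists (y - z); rewrite ?subrKC // -(mem_arcD z) subrKC.
Qed.

Lemma card_arc x : (k <= n)%N -> #|arcZ x| = k.
Proof.
move=> le_kn; rewrite -[x]addr0 -arcD_imset card_imset; last exact: addrI.
rewrite -[RHS]subn0 -[RHS](@card_ord_interval (Zp_trunc n).+2) ?Zp_cast //.
by apply: eq_card => y; rewrite !inE subr0.
Qed.

(** Arcs of length k <= n / 2 overlap on one side only, so the missing part
    is measured by the cyclic distance of their starting points, cut off at k. *)
Lemma card_arcD x y : (2 * k <= n)%N ->
  #|arcZ x :\: arcZ y| = minn k (minn (x - y)%R (n - (x - y)%R)).
Proof.
move=> le_kn.
have -> : arcZ x :\: arcZ y = [set y + z | z in arcZ (x - y) :\: arcZ 0].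
  have memE t u : (y + t \in arcZ (y + u) :\: arcZ y) = (t \in arcZ u :\: arcZ 0).
    by rewrite !in_setD -{2}[y]addr0 !mem_arcD.
  apply/setP => t; apply/idP/imsetP => [xyt|[z zin ->]].
    by exists (t - y); rewrite ?subrKC // -memE !subrKC.
  by rewrite -memE subrKC in zin.
rewrite card_imset; last exact: addrI.
move: (x - y) => {x y} d; have lt_dn := ltn_Zp d.
pose m := minn n (d + k); rewrite -(_ : m - maxn k d = minn k (minn d (n - d)))%N; last lia.
rewrite -(@card_ord_interval (Zp_trunc n).+2 (maxn k d) m) ?Zp_cast //; last lia.
apply: eq_card => z; rewrite !inE subr0 val_subZ; have := ltn_Zp z.
by rewrite /m; case: (leqP d z) => ? ?; lia.
Qed.

Lemma arc_inj : (0 < k)%N -> (2 * k <= n)%N -> injective arcZ.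
Proof.
move=> k_gt0 le_kn x y eq_xy; apply/eqP; rewrite -subr_eq0; apply/eqP.
have := card_arcD x y le_kn; rewrite eq_xy setDv cards0.
by have := ltn_Zp (x - y); move: (x - y) => d lt_dn dist_d; apply: val_inj => /=; lia.
Qed.

(** Multiplication by k permutes the residues, so the blocks of a
    wreath, which start k apart, are the images of all the arcs. *)
Lemma wreathE (p : {perm 'Z_n}) : (k < n)%N -> coprime n k ->
  wreath k p = [set p @: arcZ x | x : 'Z_n].
Proof.
move=> lt_kn co_nk.
have Uk : (k%:R : 'Z_n) \is a GRing.unit by rewrite unitZpE.
have blockE i : wreath_block k p i = p @: arcZ ((i - 1) * k%:R + 1).
  (* The block of index i is the arc starting at (i - 1) k + 1. *)
  rewrite /wreath_block; set c := _ * _.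
  have shiftE (j : nat) : c + j.+1%:R = (c + 1) + j%:R by rewrite -natr1 addrA addrAC.
  apply/setP => z; apply/imsetP/imsetP => [[j _ ->]|[y]].
    exists (c + j.+1%:R) => //; rewrite shiftE inE [(_ + j%:R)%R]addrC addrK.
    by rewrite val_natZ // (ltn_trans (ltn_ord j)).
  rewrite inE; rewrite -[in p y](subrKC (c + 1) y).
  move: (y - (c + 1)) => d lt_dk ->; exists (Ordinal lt_dk) => //=.
  by rewrite shiftE natr_Zp.
apply/setP => B; apply/imsetP/imsetP => [[i _ ->]|[x _ ->]].
  by rewrite blockE; eexists.
by exists ((x - 1) / k%:R + 1) => //; rewrite blockE addrK divrK ?subrK.
Qed.

Definition rotation (a : 'Z_n) : {perm 'Z_n} := perm (addrI a).
Definition reflection (a : 'Z_n) : {perm 'Z_n} := perm (subrI a).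

Lemma rotation_arc a x : rotation a @: arcZ x = arcZ (a + x).
Proof. by rewrite -arcD_imset; apply: eq_imset => y; rewrite permE. Qed.

Lemma reflection_arc a x : (0 < k <= n)%N ->
  reflection a @: arcZ x = arcZ (a - x - k.-1%:R).
Proof.
move=> /andP[k_gt0 le_kn].
apply/setP => y; rewrite -[y in LHS](subKr a) -[a - (a - y)](permE (subrI a)).
rewrite mem_imset; last exact: perm_inj.
rewrite !inE.
have -> : y - (a - x - k.-1%:R) = k.-1%:R - (a - y - x).
  by rewrite !opprB; ring.
move: (a - y - x) => d; rewrite val_subZ val_natZ; last by lia.
by have := ltn_Zp d; case: ifP; lia.
Qed.

(** The arcs starting at z and ending at z have only z in common. *)
Lemma perm_fix_arcs (s : {perm 'Z_n}) : (0 < k)%N -> (2 * k <= n)%N ->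
  (forall x, s @: arcZ x = arcZ x) -> s = 1%g.
Proof.
move=> k_gt0 le_kn fix_s; apply/permP => z; rewrite perm1.
have s_arc x : z \in arcZ x -> s z \in arcZ x by rewrite -{2}[arcZ x]fix_s; apply: imset_f.
have := s_arc z; rewrite !inE subrr => /(_ k_gt0) lt1.
have := s_arc (z - k.-1%:R); rewrite !inE opprB [_ - z]addrC addrA subrr add0r.
rewrite addrA val_addZ val_natZ; last by lia.
move=> /(_ ltac:(lia)); have := ltn_Zp (s z - z) => lt3 lt2.
apply/eqP; rewrite -subr_eq0; apply/eqP.
move: (s z - z) lt1 lt2 lt3 => d lt1 lt2 lt3; apply: val_inj => /=.
by move: lt2; case: ifP; lia.
Qed.

Lemma reflection_rotation_neq a b : (2 < n)%N -> reflection a != rotation b.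
Proof.
move=> n_gt2; apply/eqP => /permP eq_ab.
have := eq_ab 0; rewrite !permE subr0 addr0 => eab.
have := eq_ab 1; rewrite !permE eab => /addrI /eqP.
rewrite -subr_eq0 -opprD oppr_eq0 -mulr2n => /eqP/(congr1 (@nat_of_ord _)).
by rewrite val_natZ.
Qed.

Definition dihedral : {set {perm 'Z_n}} :=
  [set rotation a | a : 'Z_n] :|: [set reflection a | a : 'Z_n].

Lemma card_dihedral : (2 < n)%N -> #|dihedral| = (2 * n)%N.
Proof.
move=> n_gt2; rewrite cardsU disjoint_setI0 ?cards0 ?subn0; last first.
  apply/pred0P => s /=; apply/negP => /andP[/imsetP[a _ ->] /imsetP[b _ /esym/eqP]].
  by apply/negP; apply: reflection_rotation_neq.
rewrite !card_imset ?card_Zmod; first by lia.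
- by move=> a b /permP/(_ 0); rewrite !permE !subr0.
- by move=> a b /permP/(_ 0); rewrite !permE !addr0.
Qed.

(** A permutation of the arcs induces a map g on starting points.  Two arcs differ
    by one point exactly when their starting points are cyclic neighbours; so g
    preserves neighbours, and since it is injective it keeps its direction.  It is
    then a rotation or a reflection, and so is h because the arcs separate points. *)
Lemma dihedralP (h : {perm 'Z_n}) : (2 <= k)%N -> (2 * k < n)%N ->
  reflect (forall x, exists y, h @: arcZ x = arcZ y) (h \in dihedral).
Proof.
move=> k_ge2 lt_kn; apply: (iffP idP) => [|arc_h].
  rewrite inE => /orP[] /imsetP[a _ ->] x.
    by exists (a + x); rewrite rotation_arc.
  by eexists; rewrite reflection_arc //; lia.
have [g gE] := fin_all_exists arc_h.
have cardg x y : #|arcZ (g x) :\: arcZ (g y)| = #|arcZ x :\: arcZ y|.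
  rewrite -!gE -(card_imset (arcZ x :\: arcZ y) (@perm_inj _ h)); congr #|pred_of_set _|.
  apply/setP => z; rewrite -[z](permKV h) in_setD !mem_imset; try exact: perm_inj.
  by rewrite in_setD.
have card1 x y : #|arcZ x :\: arcZ y| = 1%N <-> (x - y = 1 \/ x - y = -1).
  rewrite card_arcD; last by lia.
  have := ltn_Zp (x - y); move: (x - y) => {x y} d lt_dn.
  have v1 : nat_of_ord (1 : 'Z_n) = 1%N by rewrite -[1]/(1%:R) val_natZ.
  have vN1 : nat_of_ord (- 1 : 'Z_n) = n.-1.
    by rewrite -[- 1]add0r val_subZ v1 /=; lia.
  split=> [dist|[->|->]]; rewrite ?v1 ?vN1; try lia.
  have [d1|d1] := eqVneq (d : nat) 1%N; [left|right]; apply: ord_inj.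
    by rewrite v1.
  by rewrite vN1; lia.
have gS x : g (x + 1) - g x = 1 \/ g (x + 1) - g x = -1.
  by apply/card1; rewrite cardg; apply/card1; left; rewrite addrC addKr.
have g_inj : injective g.
  move=> x y eq_g; apply: arc_inj; try lia.
  by apply: (imset_inj (@perm_inj _ h)); rewrite !gE eq_g.
have n_neq0 : (1 + 1 : 'Z_n) != 0.
  by apply/eqP => /(congr1 (@nat_of_ord _)); rewrite -mulr2n val_natZ //; lia.
(* The direction cannot be reversed, for g would take the same value twice. *)
have gSS x e : g (x + 1) - g x = e -> g (x + 1 + 1) - g (x + 1) = e.
  move=> g1; have := gS (x + 1); have := gS x; rewrite g1.
  have neq : e + (g (x + 1 + 1) - g (x + 1)) != 0.
    rewrite -g1 addrC subrKA subr_eq0 (inj_eq g_inj) -subr_eq0.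
    by rewrite addrAC (addrC x) addrK.
  by move=> [] ee [] ed; rewrite ee ed ?subrr ?addNr ?eqxx in neq *.
have [e ge] : exists e, forall m : nat, g m%:R = g 0 + e *+ m.
  exists (g 1 - g 0).
  suff gm m : g (m%:R + 1) - g m%:R = g 1 - g 0.
    elim=> [|m IHm]; first by rewrite mulr0n addr0.
    by rewrite -natr1 mulrSr addrA -IHm -(gm m) subrKC.
  elim: m => [|m IHm]; first by rewrite add0r.
  by rewrite -natr1; apply: gSS.
have gx x : g x = g 0 + e *+ x by rewrite -ge natr_Zp.
have e_pm : e = 1 \/ e = -1.
  by have := gS 0; rewrite add0r -[1]/(1%:R) ge mulr1n addrC addKr.
have conclude s : s \in dihedral -> (forall x, s @: arcZ x = h @: arcZ x) -> h \in dihedral.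
  move=> Ds sh; suff -> : h = s by [].
  apply/(mulIg s^-1)%g; rewrite mulgV; apply: perm_fix_arcs; try lia.
  move=> x; rewrite (eq_imset _ (permM h s^-1%g)) (imset_comp (s^-1)%g h) -sh -imset_comp.
  by rewrite (eq_imset _ (fun y => permK s y)) imset_id.
case: e_pm => ee.
  apply: (conclude (rotation (g 0))); first by apply/setUP; left; apply: imset_f.
  by move=> x; rewrite rotation_arc gE (gx x) ee natr_Zp.
apply: (conclude (reflection (g 0 + k.-1%:R))); first by apply/setUP; right; apply: imset_f.
move=> x; rewrite reflection_arc; last by lia.
by rewrite gE (gx x) ee mulNrn natr_Zp addrAC addrK.
Qed.

Lemma card_wreath_fibre (p : {perm 'Z_n}) : (2 <= k)%N -> (2 * k < n)%N -> coprime n k ->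
  #|[set q | wreath k q == wreath k p]| = (2 * n)%N.
Proof.
move=> k_ge2 lt_kn co_nk; rewrite -card_dihedral; last by lia.
rewrite -(card_imset dihedral (mulIg p)); apply: eq_card => q; rewrite inE.
have comp (s t : {perm 'Z_n}) (B : {set 'Z_n}) : (s * t)%g @: B = t @: (s @: B).
  by rewrite (eq_imset _ (permM s t)) (imset_comp t s).
rewrite !wreathE //; try lia; apply/eqP/imsetP => [eq_qp|[h Dh ->{q}]].
  exists (q * p^-1)%g; last by rewrite mulgKV.
  apply/dihedralP => // x; have : q @: arcZ x \in [set p @: arcZ x | x : 'Z_n].
    by rewrite -eq_qp imset_f.
  case/imsetP=> y _ eq_y; exists y.
  by rewrite comp eq_y -comp mulgV (eq_imset _ (@perm1 _)) imset_id.
have/dihedralP arc_h := Dh.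
apply/eqP; rewrite eqEcard; apply/andP; split.
  apply/subsetP => _ /imsetP[x _ ->]; have [//|//|y eq_y] := arc_h _ _ x.
  by rewrite comp eq_y imset_f.
have inj_arc (s : {perm 'Z_n}) : injective (fun x => s @: arcZ x).
  by move=> x y /(imset_inj (@perm_inj _ s)); apply: arc_inj; lia.
by rewrite (card_imset _ (inj_arc p)) (card_imset _ (inj_arc _)).
Qed.

End Arcs.

(** * Functions on sets alternating under pairs of points *)

Lemma sum_card_sets (F : numFieldType) l (G : nat -> F) :
  \sum_(C : {set 'I_l}) G #|C| = \sum_(q < l.+1) 'C(l, q)%:R * G q.
Proof.
have lt_card (C : {set 'I_l}) : (#|C| < l.+1)%N by rewrite ltnS -[X in (_ <= X)%N]card_ord max_card.
rewrite (partition_big (fun C => Ordinal (lt_card C)) xpredT) //=.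
apply: eq_bigr => q _; rewrite -[X in 'C(X, _)]card_ord -card_draws -sumr_const.
rewrite mulr_suml; apply: eq_big => [C|C /eqP <-]; first by rewrite inE.
by rewrite mul1r.
Qed.

Lemma prodr_natb (F : numFieldType) (I : finType) (P : pred I) :
  \prod_i (P i)%:R = [forall i, P i]%:R :> F.
Proof.
have [/forallP all_P|] := boolP [forall i, P i]; first by rewrite big1 // => i _; rewrite all_P.
by rewrite negb_forall => /existsP[i /negbTE nPi]; rewrite (bigD1 i) //= nPi mul0r.
Qed.

Section PairSign.
Variables (F : numFieldType) (T : finType) (l : nat) (a b : 'I_l -> T).
Hypotheses (a_inj : injective a) (b_inj : injective b) (neq_ab : forall i j, a i != b j).
Implicit Types (B : {set T}) (f : {set T} -> F).

Definition pair_sign B : F := \prod_i ((b i \in B)%:R - (a i \in B)%:R).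

Definition outside_pairs x := forall i, (x != a i) && (x != b i).

Definition pair_alternating f :=
  (forall i B, f (tperm (a i) (b i) @: B) = - f B) /\
  (forall x y B, outside_pairs x -> outside_pairs y -> f (tperm x y @: B) = f B).

Lemma mem_tperm_imset x y z B : (z \in tperm x y @: B) = (tperm x y z \in B).
Proof. by rewrite -{1}[z](tpermK x y) mem_imset //; apply: perm_inj. Qed.

Lemma pair_sign_alternating : pair_alternating pair_sign.
Proof.
split=> [i B|x y B out_x out_y]; last first.
  apply: eq_bigr => i _; rewrite !mem_tperm_imset.
  have /andP[xa xb] := out_x i; have /andP[ya yb] := out_y i.
  by rewrite !tpermD.
rewrite /pair_sign (bigD1 i) //= [in RHS](bigD1 i) //= -mulNr; congr (_ * _).
  by rewrite !mem_tperm_imset tpermL tpermR opprB.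
apply: eq_bigr => j neq_ji; rewrite !mem_tperm_imset !tpermD //.
- by rewrite (inj_eq a_inj) eq_sym.
- by rewrite eq_sym.
- by rewrite (inj_eq b_inj) eq_sym.
Qed.

Lemma tperm_imset_id x y B : (x \in B) = (y \in B) -> tperm x y @: B = B.
Proof.
by move=> eq_xy; apply/setP => z; rewrite mem_tperm_imset; case: tpermP => [->|->|].
Qed.

Lemma card_tperm_setD x y B B0 : x \in B :\: B0 -> y \in B0 :\: B ->
  (#|(tperm x y @: B) :\: B0| < #|B :\: B0|)%N.
Proof.
move=> Bx By; rewrite [X in (_ < X)%N](cardsD1 x) Bx ltnS; apply: subset_leq_card.
move: Bx By; rewrite !inE => /andP[nB0x Bx] /andP[nBy B0y].
apply/subsetP => z; rewrite !inE mem_tperm_imset => /andP[nB0z].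
rewrite nB0z; case: tpermP => [->|eq_zy|/eqP -> _ ->] //; first by rewrite (negbTE nBy).
by rewrite eq_zy B0y in nB0z.
Qed.

(** Exchanges of points bring B to B0 step by step, with the same effect on both
    functions, unless B contains both or neither of some a_i and b_i; but then
    both functions vanish at B. *)
Lemma pair_alternating_unique f h B0 B :
  pair_alternating f -> pair_alternating h -> h B0 = 1 ->
  (forall i, b i \in B0) -> (forall i, a i \notin B0) -> #|B| = #|B0| ->
  f B = f B0 * h B.
Proof.
move=> [f_alt f_sym] [h_alt h_sym] h1 B0b B0a.
(* Exchanging a_i and b_i fixes a set that contains both or neither of them, yet
   it changes the sign of the value at that set. *)
have vanish (g : {set T} -> F) i (C : {set T}) :
    (forall j (D : {set T}), g (tperm (a j) (b j) @: D) = - g D) ->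
    (a i \in C) = (b i \in C) -> g C = 0 :> F.
  move=> g_alt eq_i; have := g_alt i C; rewrite tperm_imset_id // => /eqP.
  by rewrite -addr_eq0 -mulr2n mulrn_eq0 => /eqP.
move Dm: #|B :\: B0| => m; elim/ltn_ind: m B Dm => m IHm B Dm cB.
have swap x y : x \in B :\: B0 -> y \in B0 :\: B ->
    f (tperm x y @: B) = f B0 * h (tperm x y @: B).
  move=> Bx By; apply: (IHm #|(tperm x y @: B) :\: B0|) => //.
    by rewrite -Dm card_tperm_setD.
  by rewrite card_imset ?cB //; apply: perm_inj.
have [i /= bad_i|good] := pickP (fun i => (a i \in B) || (b i \notin B)).
  have [eq_i|neq_i] := eqVneq (a i \in B) (b i \in B).
    by rewrite (vanish f i) // (vanish h i) // mulr0.
  have := swap (a i) (b i); rewrite !inE B0a B0b f_alt h_alt mulrN.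
  move: bad_i neq_i; case: (a i \in B); case: (b i \in B) => //= _ _ /(_ isT isT).
  by move/oppr_inj.
have Bab i : (a i \notin B) && (b i \in B) by rewrite -[b i \in B]negbK -negb_or good.
have [BB0|] := boolP (B :\: B0 == set0).
  suff -> : B = B0 by rewrite h1 mulr1.
  by apply/eqP; rewrite eqEcard cB leqnn andbT -setD_eq0.
case/set0Pn => x Bx.
have : (0 < #|B0 :\: B|)%N by rewrite cardsD setIC -cB -cardsD; apply/card_gt0P; exists x.
case/card_gt0P => y By.
have out z : (z \in B) != (z \in B0) -> outside_pairs z.
  move=> neq i; have /andP[/negbTE Ba Bb] := Bab i.
  by apply/andP; split; apply: contraNneq neq => ->; rewrite ?Ba ?Bb ?B0b ?(negbTE (B0a i)).
have [out_x out_y] : outside_pairs x /\ outside_pairs y.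
  move: Bx By; rewrite !inE => /andP[/negbTE nBx Bx] /andP[/negbTE nBy By].
  by split; apply: out; rewrite ?nBx ?Bx ?nBy ?By.
by have := swap x y Bx By; rewrite f_sym ?h_sym.
Qed.

(** Expanding the product over the pairs as a sum over the set C of those i
    whose a-point is the one required to lie in p(J), the sum becomes a signed
    count of permutations, which depends on C only through its cardinality. *)
Lemma sum_pair_sign_placing (k : nat) (B0 J0 J : {set T}) :
  #|B0| = k -> #|J0| = k -> #|J| = k ->
  (forall i, b i \in B0) -> (forall i, a i \notin B0) ->
  \sum_(p : {perm T} | p @: J0 == B0) pair_sign (p @: J) =
    zonal_sum F #|T| k l #|J :\: J0|.
Proof.
move=> cB0 cJ0 cJ B0b B0a.
rewrite (reindex_inj invg_inj) /=.
have memV (s : {perm T}) x B : (x \in (s^-1)%g @: B) = (s x \in B).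
  by rewrite -{1}[x](permK s) mem_imset //; apply: perm_inj.
have imV (s : {perm T}) B C : ((s^-1)%g @: B == C) = (s @: C == B).
  apply/eqP/eqP => [<-|<-]; apply/setP => x.
    by rewrite -{1}[x](permKV s) mem_imset ?memV ?permKV //; apply: perm_inj.
  by rewrite memV mem_imset //; apply: perm_inj.
pose As (C : {set 'I_l}) := [set a i | i in C].
pose Bs (C : {set 'I_l}) := [set b i | i in ~: C].
have expand (s : {perm T}) : pair_sign ((s^-1)%g @: J) = \sum_(C : {set 'I_l})
    (-1) ^+ #|C| * ((s @: Bs C \subset J) && (s @: As C \subset J))%:R.
  rewrite /pair_sign; under eq_bigr do rewrite !memV addrC.
  rewrite bigA_distr; apply: eq_bigr => C _.
  transitivity (\prod_i ((if i \in C then -1 else 1) *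
      (s (if i \in C then a i else b i) \in J)%:R) : F).
    by apply: eq_bigr => i _; case: ifP; rewrite ?mulN1r ?mul1r.
  rewrite big_split /= -big_mkcond prodr_const prodr_natb; congr (_ * (nat_of_bool _)%:R).
  apply/forallP/andP => [sJ|[/subsetP sB /subsetP sA] i].
    split; apply/subsetP => _ /imsetP[_ /imsetP[i Ci ->] ->]; have := sJ i.
      by move: Ci; rewrite inE => /negbTE ->.
    by rewrite Ci.
  by case: ifPn => Ci; [apply: sA | apply: sB]; rewrite !imset_f ?inE.
under eq_bigr do rewrite expand.
pose G q : F := (-1) ^+ q *
   ((k - #|J :\: J0|) ^_ (l - q) * (k - (l - q))`! * (#|J :\: J0| ^_ q * (#|T| - k - q)`!))%:R.
transitivity (\sum_(q < l.+1) 'C(l, q)%:R * G q); last first.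
  by apply: eq_bigr => q _; rewrite [in RHS]natrM mulrCA.
rewrite exchange_big -sum_card_sets /=; apply: eq_bigr => C _.
rewrite -mulr_sumr; congr (_ * _).
have cA : #|As C| = #|C| by rewrite card_imset.
have cB : #|Bs C| = (l - #|C|)%N.
  by rewrite card_imset // -[X in (X - _)%N](card_ord l) -(cardsC C) addKn.
have cJJ : #|J0 :&: J| = (k - #|J :\: J0|)%N by rewrite -cJ -(cardsID J0 J) addnK setIC.
rewrite -cB -cA -cJJ -[in RHS](@card_perm_placing T k B0) //.
- rewrite -sum1dep_card natr_sum [RHS]big_mkcondr; apply: eq_big => s.
    by rewrite imV.
  by move=> _; case: ifP.
- by apply/subsetP => _ /imsetP[i _ ->].
- by rewrite disjoints_subset; apply/subsetP => _ /imsetP[i _ ->]; rewrite inE.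
Qed.
End PairSign.

(** * The Gram matrix of inclusion and its eigenvector *)

Section Coef.
Variables (F : numFieldType) (n k : nat).
Implicit Types (B C : {set 'Z_n}) (u : 'rV[F]_#|ksets n k|).
Implicit Types (f : {set 'Z_n} -> F) (s t : {perm 'Z_n}).

(** Total version of the coordinate at B, equal to 0 if B is not a k-set, so that
    rows can be handled as functions of sets. *)
Definition set_coef u B : F := \sum_j (enum_val j == B)%:R * u 0 j.

Definition set_row f : 'rV[F]_#|ksets n k| := \row_j f (enum_val j).

Lemma set_coef_enum_val u j : set_coef u (enum_val j) = u 0 j.
Proof.
rewrite /set_coef (bigD1 j) //= eqxx mul1r big1 ?addr0 // => i neq_ij.
by rewrite (inj_eq enum_val_inj) (negbTE neq_ij) mul0r.
Qed.

Lemma sum_ksets (G : {set 'Z_n} -> F) :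
  \sum_(j < #|ksets n k|) G (enum_val j) = \sum_(B in ksets n k) G B.
Proof. by rewrite [RHS]big_enum_val. Qed.

Lemma set_coef_row f B : #|B| = k -> set_coef (set_row f) B = f B.
Proof.
move=> cB; have kB : B \in ksets n k by rewrite inE cB.
by rewrite -[B in LHS](enum_rankK_in kB kB) set_coef_enum_val mxE enum_rankK_in.
Qed.

Lemma set_coef_out u B : B \notin ksets n k -> set_coef u B = 0.
Proof.
move=> nkB; rewrite /set_coef big1 // => j _; case: eqP => [eqB|]; last by rewrite mul0r.
by rewrite -eqB enum_valP in nkB.
Qed.

Lemma imset_perm_inj s : injective (fun B => s @: B).
Proof. exact: (imset_inj (@perm_inj _ s)). Qed.

Lemma set_coefM u s B : set_coef (u *m kset_mx F k s) (s @: B) = set_coef u B.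
Proof.
rewrite /set_coef; transitivity (\sum_(j < #|ksets n k|) \sum_(i < #|ksets n k|)
    (enum_val j == s @: B)%:R * (u 0 i * (enum_val j == s @: enum_val i)%:R)).
  by apply: eq_bigr => j _; rewrite mxE mulr_sumr; apply: eq_bigr => i _; rewrite !mxE.
rewrite exchange_big; apply: eq_bigr => i _ /=.
have ksi : s @: enum_val i \in ksets n k by rewrite imset_kset enum_valP.
rewrite (bigD1 (enum_rank_in ksi (s @: enum_val i))) //= big1 => [|j neq_j].
  by rewrite addr0 enum_rankK_in // eqxx mulr1 (inj_eq (@imset_perm_inj s)).
case: (_ =P s @: enum_val i) => [eq_j|]; last by rewrite !mulr0.
by case/eqP: neq_j; apply: enum_val_inj; rewrite enum_rankK_in.
Qed.

(** The matrix N = Phi Phi^T; its entries are spelled out so that associativity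
    of the matrix product leaves it in one piece. *)
Definition set_gram : 'M[F]_#|ksets n k| := \matrix_(i, j)
  \sum_(W in wreaths n k) (enum_val i \in W)%:R * (enum_val j \in W)%:R.

Lemma set_gramE : set_gram = Phi_mx F n k *m (Phi_mx F n k)^T.
Proof.
apply/matrixP => i j; rewrite !mxE big_enum_val.
by apply: eq_bigr => W _; rewrite !mxE.
Qed.

Lemma sum_wreath_perm (G : {set {set 'Z_n}} -> F) : (2 <= k)%N -> (2 * k < n)%N -> coprime n k ->
  \sum_(s : {perm 'Z_n}) G (wreath k s) = (2 * n)%:R * \sum_(W in wreaths n k) G W.
Proof.
move=> k_ge2 lt_kn co_nk.
have n_gt1 : (1 < n)%N by lia.
rewrite (partition_big (wreath k) (mem (wreaths n k))) /=; last by move=> s _; apply: imset_f.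
rewrite mulr_sumr; apply: eq_bigr => _ /imsetP[s _ ->].
rewrite (eq_bigr (fun=> G (wreath k s))) => [|t /eqP -> //].
rewrite sumr_const mulr_natl -(@card_wreath_fibre n k n_gt1 s) //; congr (_ *+ _).
by apply: eq_card => t; rewrite inE.
Qed.

Lemma wreath_comp s t : wreath k (s * t)%g = [set t @: (B : {set 'Z_n}) | B in wreath k s].
Proof.
rewrite /wreath -imset_comp; apply: eq_imset => i /=.
by rewrite /wreath_block -imset_comp; apply: eq_imset => j; rewrite /= permM.
Qed.

Lemma mem_wreathM s t B : (t @: B \in wreath k (s * t)%g) = (B \in wreath k s).
Proof. by rewrite wreath_comp mem_imset //; apply: imset_perm_inj. Qed.

Section Commute.
Hypotheses (k_ge2 : (2 <= k)%N) (lt_kn : (2 * k < n)%N) (co_nk : coprime n k).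
Let n_gt1 : (1 < n)%N. Proof. by lia. Qed.
Let nz_n : (2 * n)%:R != 0 :> F. Proof. by rewrite pnatr_eq0; lia. Qed.

Lemma set_coef_gram u B : #|B| = k ->
  (2 * n)%:R * set_coef (u *m set_gram) B =
  \sum_(s : {perm 'Z_n}) (B \in wreath k s)%:R * \sum_(C in wreath k s) set_coef u C.
Proof.
move=> cB; have kB : B \in ksets n k by rewrite inE cB.
rewrite -{1}(enum_rankK_in kB kB) set_coef_enum_val mxE.
rewrite (sum_wreath_perm (fun W => (B \in W)%:R * \sum_(C in W) set_coef u C)) //.
congr (_ * _).
under eq_bigr => i _ do rewrite mxE enum_rankK_in // mulr_sumr.
rewrite exchange_big /=; apply: eq_bigr => W /imsetP[s _ ->{W}].
transitivity (\sum_(C in ksets n k) (B \in wreath k s)%:R * ((C \in wreath k s)%:R * set_coef u C)).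
  rewrite -sum_ksets; apply: eq_bigr => i _.
  by rewrite set_coef_enum_val mulrC [_%:R * _%:R]mulrC mulrA.
rewrite -mulr_sumr; congr (_ * _).
rewrite big_mkcond [RHS]big_mkcond; apply: eq_bigr => C _.
case: (boolP (C \in ksets n k)) => [_|nkC]; last by rewrite set_coef_out ?if_same.
by case: ifP => _; rewrite ?mul1r ?mul0r.
Qed.

Lemma set_coef_gramM u s B : #|B| = k ->
  set_coef (u *m kset_mx F k s *m set_gram) (s @: B) = set_coef (u *m set_gram) B.
Proof.
move=> cB; have csB : #|s @: B| = k by rewrite card_imset //; apply: perm_inj.
apply: (mulfI nz_n); rewrite !set_coef_gram //.
rewrite (reindex_inj (mulIg s)); apply: eq_bigr => t _ /=; rewrite mem_wreathM; congr (_ * _).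
rewrite wreath_comp big_imset /=; last by move=> C D _ _; apply: imset_perm_inj.
by apply: eq_bigr => C _; rewrite set_coefM.
Qed.

Lemma set_coef_inj u v : (forall B, #|B| = k -> set_coef u B = set_coef v B) -> u = v.
Proof.
move=> eq_uv; apply/rowP => j; rewrite -!set_coef_enum_val; apply: eq_uv.
by apply/eqP; have := enum_valP j; rewrite inE.
Qed.

(** Relabelling the points permutes the wreaths. *)
Lemma set_gram_comm s : kset_mx F k s *m set_gram = set_gram *m kset_mx F k s.
Proof.
apply/row_matrixP => i; rewrite !rowE !mulmxA; apply: set_coef_inj => B cB.
have cVB : #|(s^-1)%g @: B| = k by rewrite card_imset //; apply: perm_inj.
have -> : B = s @: ((s^-1)%g @: B).
  rewrite -imset_comp (eq_imset _ (_ : _ =1 id)) ?imset_id // => x /=.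
  by rewrite permKV.
by rewrite set_coef_gramM // set_coefM.
Qed.

Lemma sum_Zp (G : nat -> F) : \sum_(x : 'Z_n) G x = \sum_(x < n) G x.
Proof. by rewrite -!(big_mkord xpredT G) Zp_cast. Qed.

Lemma wreaths_sub_ksets W : W \in wreaths n k -> W \subset ksets n k.
Proof.
case/imsetP=> s _ ->; rewrite wreathE //; last by lia.
apply/subsetP => _ /imsetP[x _ ->]; rewrite inE card_imset ?card_arc //; first by lia.
exact: perm_inj.
Qed.

(** Wreaths consist of k-sets, so the intersection of two of them is counted
    by summing over k-sets. *)
Lemma wreath_mx_gram : wreath_mx F n k = (Phi_mx F n k)^T *m Phi_mx F n k.
Proof.
apply/matrixP => i j; rewrite !mxE -sum1_card natr_sum.
under [RHS]eq_bigr do rewrite !mxE.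
rewrite (sum_ksets (fun C => (C \in enum_val i)%:R * (C \in enum_val j)%:R)).
rewrite big_mkcond [RHS]big_mkcond; apply: eq_bigr => C _; rewrite inE.
have [Wi|nWi] := boolP (C \in enum_val i); last by rewrite mul0r if_same.
by rewrite mul1r (subsetP (wreaths_sub_ksets (enum_valP i)) C Wi); case: (C \in _).
Qed.

Section Eigen.
Variables (l : nat) (a b : 'I_l -> 'Z_n) (B0 : {set 'Z_n}).
Hypotheses (a_inj : injective a) (b_inj : injective b) (neq_ab : forall i j, a i != b j).
Hypotheses (card_B0 : #|B0| = k) (B0b : forall i, b i \in B0) (B0a : forall i, a i \notin B0).

Let w := set_row (pair_sign F a b).

Definition pair_alternating_row u :=
  (forall i, u *m kset_mx F k (tperm (a i) (b i)) = - u) /\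
  (forall x y, outside_pairs a b x -> outside_pairs a b y -> u *m kset_mx F k (tperm x y) = u).

Lemma set_coefN u B : set_coef (- u) B = - set_coef u B.
Proof. by rewrite /set_coef -sumrN; apply: eq_bigr => i _; rewrite mxE mulrN. Qed.

Lemma pair_sign_support : pair_sign F a b B0 = 1.
Proof. by rewrite /pair_sign big1 // => i _; rewrite B0b (negbTE (B0a i)) subr0. Qed.

Lemma pair_alternating_rowE u : pair_alternating_row u -> u = set_coef u B0 *: w.
Proof.
case=> u_alt u_sym; apply: set_coef_inj => B cB.
have -> : set_coef (set_coef u B0 *: w) B = set_coef u B0 * pair_sign F a b B.
  rewrite -(set_coef_row (pair_sign F a b) cB) -/w /set_coef mulr_sumr.
  by apply: eq_bigr => i _; rewrite mxE mulrCA.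
apply: (pair_alternating_unique _ (pair_sign_alternating _ a_inj b_inj neq_ab)) => //.
- split=> [i C|x y C out_x out_y].
    by rewrite -[in LHS](opprK u) -(u_alt i) set_coefN set_coefM.
  by rewrite -{1}(u_sym x y) // set_coefM.
- exact: pair_sign_support.
- by rewrite card_B0.
Qed.

Lemma pair_alternating_row_gram u :
  pair_alternating_row u -> pair_alternating_row (u *m set_gram).
Proof.
case=> u_alt u_sym; split=> [i|x y out_x out_y]; rewrite -mulmxA -set_gram_comm mulmxA.
  by rewrite u_alt mulNmx.
by rewrite u_sym.
Qed.

Definition gram_eigenvalue := set_coef (w *m set_gram) B0.

(** The Gram matrix preserves the symmetries that determine a row up to a
    factor. *)
Lemma gram_eigenvector u : pair_alternating_row u -> u *m set_gram = gram_eigenvalue *: u.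
Proof.
move=> alt_u; rewrite [LHS](pair_alternating_rowE (pair_alternating_row_gram alt_u)).
rewrite [in RHS](pair_alternating_rowE alt_u) scalerA; congr (_ *: _).
rewrite {1}(pair_alternating_rowE alt_u) -scalemxAl mulrC /gram_eigenvalue.
by rewrite /set_coef mulr_sumr; apply: eq_bigr => i _; rewrite [in LHS]mxE mulrCA.
Qed.

(** Averaging over the 2 n permutations behind each wreath turns the coordinate
    at B0 into a sum over permutations and pairs of arcs.  Rotations reduce it to the
    case where the arc sent onto B0 is the arc of 0, which gives a factor n. *)
Lemma gram_eigenvalueE : 2 * gram_eigenvalue = (n - k - l)`!%:R * (eigen_poly F k l).[n%:R].
Proof.
have le_lk : (l <= k)%N.
  rewrite -card_B0 -[l]card_ord -(card_codom b_inj); apply: subset_leq_card.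
  by apply/subsetP => _ /codomP[i ->].
rewrite -sum_zonal_distance // -(sum_Zp (fun x => zonal_sum F n k l (minn k (minn x (n - x))))).
rewrite /gram_eigenvalue.
have nz : n%:R != 0 :> F by rewrite pnatr_eq0; lia.
apply: (mulfI nz); rewrite mulrA -natrM mulnC set_coef_gram //.
pose G (p : {perm 'Z_n}) := \sum_(x : 'Z_n) pair_sign F a b (p @: arcZ k x).
have imcomp s t B : (s * t)%g @: B = t @: (s @: B).
  by rewrite (eq_imset _ (permM s t)) (imset_comp t s).
have arc_inj_p (s : {perm 'Z_n}) : injective (fun x => s @: arcZ k x).
  by move=> x y /imset_perm_inj; apply: arc_inj; lia.
have GE (p : {perm 'Z_n}) : \sum_(C in wreath k p) set_coef w C = G p.
  rewrite wreathE //; last by lia.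
  rewrite big_imset /=; last by move=> x y _ _; apply: arc_inj_p.
  apply: eq_bigr => x _; rewrite set_coef_row //.
  by rewrite card_imset ?card_arc //; [lia | apply: perm_inj].
transitivity (\sum_(y : 'Z_n) \sum_(p : {perm 'Z_n} | p @: arcZ k y == B0) G p).
  transitivity (\sum_(p : {perm 'Z_n}) \sum_(y : 'Z_n | p @: arcZ k y == B0) G p).
    apply: eq_bigr => p _; rewrite GE wreathE //; last by lia.
    case: imsetP => [[y _ eq_y]|nB0].
      rewrite mul1r (bigD1 y) ?eq_y //= big1 ?addr0 // => z /andP[/eqP/arc_inj_p ->].
      by rewrite eqxx.
    rewrite mul0r big1 // => y /eqP eq_y; by case: nB0; exists y.
  by rewrite (exchange_big_dep xpredT).
have rotG a0 p : G (rotation a0 * p)%g = G p.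
  rewrite /G [RHS](reindex_inj (addrI a0)); apply: eq_bigr => x _ /=.
  by rewrite imcomp rotation_arc.
transitivity (\sum_(y : 'Z_n) \sum_(p : {perm 'Z_n} | p @: arcZ k 0 == B0) G p).
  apply: eq_bigr => y _; rewrite (reindex_inj (mulgI (rotation (- y)))) /=.
  by apply: eq_big => [p|p _]; rewrite ?rotG // imcomp rotation_arc addNr.
rewrite sumr_const card_Zmod // mulr_natl; congr (_ *+ _).
rewrite exchange_big; apply: eq_bigr => x _.
have lekn : (k <= n)%N by lia.
have := @sum_pair_sign_placing F _ _ _ _ a_inj b_inj k B0 (arcZ k 0) (arcZ k x).
rewrite card_Zmod // !card_arc // => -> //.
by rewrite card_arcD // ?subr0 //; lia.
Qed.

End Eigen.
End Commute.
End Coef.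

(** * Generating the Specht module by one polytabloid *)

Section SpechtGenerator.
Variables (F : numFieldType) (n l : nat).
Hypothesis lt_ln : (2 * l < n)%N.
Hypothesis n_gt1 : (1 < n)%N.

Definition upper_box (i : 'I_l) : 'Z_n := i%:R.
Definition lower_box (i : 'I_l) : 'Z_n := (n - l + i)%:R.

Lemma val_upper_box i : upper_box i = i :> nat.
Proof. by rewrite val_natZ //; have := ltn_ord i; lia. Qed.

Lemma val_lower_box i : lower_box i = (n - l + i)%N :> nat.
Proof. by rewrite val_natZ //; have := ltn_ord i; lia. Qed.

Lemma upper_box_inj : injective upper_box.
Proof.
by move=> i j /(congr1 (@nat_of_ord _)); rewrite !val_upper_box => /ord_inj.
Qed.

Lemma lower_box_inj : injective lower_box.
Proof.
by move=> i j /(congr1 (@nat_of_ord _)); rewrite !val_lower_box => /addnI/ord_inj.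
Qed.

Lemma upper_lower_neq i j : upper_box i != lower_box j.
Proof.
apply/eqP => /(congr1 (@nat_of_ord _)); rewrite val_upper_box val_lower_box.
by have := ltn_ord i; lia.
Qed.

Lemma col_stab1P (s : {perm 'Z_n}) :
  reflect (forall p, box_col l (s p) = box_col l p) (s \in col_stab l 1%g).
Proof.
rewrite inE; apply: (iffP forallP) => [st p|st p].
  by have /eqP := st p; rewrite invg1 !perm1.
by rewrite invg1 !perm1 st.
Qed.

Lemma box_col_upper i : box_col l (upper_box i) = i.
Proof. by rewrite /box_col val_upper_box ifT //; have := ltn_ord i; lia. Qed.

Lemma box_col_lower i : box_col l (lower_box i) = i.
Proof. by rewrite /box_col val_lower_box ifF ?addKn //; apply/negbTE; rewrite -leqNgt leq_addr. Qed.

(** The signed sum over a group is multiplied by the sign of any of its elements. *)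
Lemma polytabloid_col_stab s : s \in col_stab l 1%g ->
  polytabloid F l (1%g : {perm 'Z_n}) *m kset_mx F l s = (-1) ^+ s *: polytabloid F l 1%g.
Proof.
move=> Cs; rewrite /polytabloid mulmx_suml scaler_sumr [RHS](reindex_inj (mulIg s)).
apply: eq_big => [t|t _].
  apply/col_stab1P/col_stab1P => st p; rewrite ?permM.
    by rewrite (col_stab1P _ Cs) st.
  by rewrite -[LHS](col_stab1P _ Cs) -permM st.
rewrite -scalemxAl kset_vecM scalerA odd_permM signr_addb mulrC -mulrA -signr_addb addbb mulr1.
by rewrite (eq_imset _ (permM t s)) (imset_comp s t).
Qed.

(** The tabloids in the sum only involve points of the first l columns. *)
Lemma polytabloid_outside (s : {perm 'Z_n}) :
  (forall i, s (upper_box i) = upper_box i) -> (forall i, s (lower_box i) = lower_box i) ->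
  polytabloid F l (1%g : {perm 'Z_n}) *m kset_mx F l s = polytabloid F l 1%g.
Proof.
move=> s_up s_low; rewrite /polytabloid mulmx_suml; apply: eq_bigr => t /col_stab1P Ct.
rewrite -scalemxAl kset_vecM; congr (_ *: kset_vec _ _ _).
rewrite -[RHS](imset_id); apply: eq_in_imset => _ /imsetP[_ /imsetP[p + ->] ->].
rewrite inE perm1 => le_p; have lt_pn := ltn_Zp n_gt1 p.
have lt_tn := ltn_Zp n_gt1 (t p).
have lt_il : (p - (n - l) < l)%N by lia.
have := Ct p; rewrite /box_col (ltnNge p) le_p /=; case: ltnP => t_p ecol.
  have -> : t p = upper_box (Ordinal lt_il) by apply: ord_inj; rewrite val_upper_box.
  exact: s_up.
have -> : t p = lower_box (Ordinal lt_il) by apply: ord_inj; rewrite val_lower_box /=; lia.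
exact: s_low.
Qed.

(** The identity is the only element of the column group that stabilises the
    second row, so the coordinate at that row is 1. *)
Lemma polytabloid_neq0 : polytabloid F l (1%g : {perm 'Z_n}) != 0.
Proof.
pose B := second_row l (1%g : {perm 'Z_n}).
have memB p : (p \in B) = (n - l <= p)%N.
  apply/imsetP/idP => [[q + ->]|le_p]; first by rewrite inE perm1.
  by exists p; rewrite ?inE ?perm1.
have kB : B \in ksets n l.
  rewrite inE (eq_card (B := [set p : 'Z_n | (n - l <= p < n)%N])) => [|p].
    by rewrite card_ord_interval ?Zp_cast // subKn //; lia.
  by rewrite memB inE ltn_Zp ?andbT.
apply/eqP => /rowP /(_ (enum_rank_in kB B)); rewrite /polytabloid summxE mxE.
rewrite (bigD1 1%g) /=; last by apply/col_stab1P => p; rewrite perm1.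
rewrite big1 ?addr0 => [|s /andP[/col_stab1P Cs neq_s1]]; last first.
  rewrite !mxE enum_rankK_in //; case: eqP => [eqB|]; last by rewrite mulr0.
  case/eqP: neq_s1; apply/permP => p; rewrite perm1; apply: ord_inj.
  have := Cs p; have : (s p \in B) = (p \in B) by rewrite {1}eqB mem_imset //; apply: perm_inj.
  have := ltn_Zp n_gt1 p; have := ltn_Zp n_gt1 (s p).
  rewrite !memB /box_col.
  by case: (ltnP (s p) (n - l)) => ?; case: (ltnP p (n - l)) => ?; lia.
rewrite !mxE enum_rankK_in // (eq_imset _ (@perm1 _)) imset_id eqxx odd_perm1 mulr1.
by move/eqP; rewrite oner_eq0.
Qed.

(** The image of the polytabloid under the isomorphism: it generates U and
    satisfies the same eigenvector equations. *)
Lemma rsim_generator k (U : 'M[F]_#|ksets n k|) (modU : mxmodule (kset_repr F n k) U) :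
  mx_rsim (submod_repr modU) (submod_repr (specht_mod F n l)) ->
  exists u : 'rV[F]_#|ksets n k|,
  [/\ u != 0, (u <= U)%MS, (U <= \sum_(s : {perm 'Z_n}) <<u *m kset_mx F k s>>)%MS
     & forall s c,
       polytabloid F l (1%g : {perm 'Z_n}) *m kset_mx F l s = c *: polytabloid F l 1%g ->
       u *m kset_mx F k s = c *: u].
Proof.
move=> /mx_rsim_sym[B eq_rank freeB homB].
set S := specht F n l in eq_rank freeB homB *.
set e := polytabloid F l (1%g : {perm 'Z_n}).
have eS s : (polytabloid F l s <= S)%MS.
  by rewrite /S /specht (sumsmx_sup s) // genmxE.
(* The isomorphism, extended to all rows of the permutation module. *)
pose psi m (v : 'M_(m, _)) := val_submod (in_submod S v *m B).
have psiZ c (v : 'rV_#|ksets n l|) : psi _ (c *: v) = c *: psi _ v.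
  by rewrite /psi !linearZ /= -scalemxAl linearZ.
have psiM s v : (v <= S)%MS -> psi 1%N v *m kset_mx F k s = psi 1%N (v *m kset_mx F l s).
  move=> Sv; rewrite /psi -(val_submodJ modU) ?inE // -mulmxA -homB ?inE // mulmxA.
  by rewrite -(in_submodJ (specht_mod F n l)) ?inE.
exists (psi _ e); split.
- rewrite val_submod_eq0 mulmx_free_eq0 //; apply: contra polytabloid_neq0 => /eqP e0.
  by rewrite -/e -(in_submodK (eS 1%g : (e <= S)%MS)) e0 linear0.
- exact: val_submodP.
- have psiE m (v : 'M_(m, _)) : psi m v = v *m psi _ 1%:M.
    by rewrite /psi val_submodE in_submodE [in RHS]val_submodE !mulmxA.
  have UB : (U <= val_submod B)%MS.
    rewrite (eqmx_sym (val_submod1 U)) val_submodS sub1mx.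
    by apply/eqP; apply: etrans (eqP freeB) eq_rank.
  apply: (submx_trans UB); rewrite -[B]mul1mx -(val_submodK (1%:M : 'M_(\rank S))) -/(psi _ _) psiE.
  apply: (submx_trans (submxMr _ (val_submodP _))).
  rewrite {1}/S /specht sumsmxMr_gen; apply/sumsmx_subP => s _.
  rewrite genmxE (eqmxMr _ (genmxE _)) (sumsmx_sup s) // genmxE.
  by rewrite -psiE psiM ?(eS 1%g) // /e polytabloidM mul1g.
by move=> s c eq_e; rewrite psiM ?(eS 1%g) // eq_e psiZ.
Qed.

End SpechtGenerator.

(** * Identification of the polynomial *)

(** If the Gram eigenvalue is nonzero then so is Phi(U_l), which therefore
    determines the scalar c. *)
Lemma is_lambdaE (F : numFieldType) n k l (c : F) :
  (2 <= l <= k)%N -> (2 * k < n)%N -> coprime n k -> is_lambda n k l c ->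
  (eigen_poly F k l).[n%:R] != 0 ->
  2 * c = (n - k - l)`!%:R * (eigen_poly F k l).[n%:R].
Proof.
move=> /andP[le2l le_lk] lt_kn co_nk [U [_ _ simU] /= eigU] nz_poly.
have n_gt1 : (1 < n)%N by lia.
have lt_ln : (2 * l < n)%N by lia.
have k_ge2 : (2 <= k)%N by lia.
have [modU /(rsim_generator lt_ln n_gt1)[u [nz_u uU Uu symu]]] := simU l le_lk.
pose a := @upper_box n l; pose b := @lower_box n l.
have a_inj : injective a by apply: upper_box_inj.
have b_inj : injective b by apply: lower_box_inj.
have neq_ab i j : a i != b j by apply: upper_lower_neq.
(* The last k residues contain the second row and avoid the first l residues. *)
pose B0 := [set p : 'Z_n | (n - k <= p < n)%N].
have cB0 : #|B0| = k by rewrite card_ord_interval ?Zp_cast // subKn //; lia.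
have B0b i : b i \in B0.
  by rewrite inE val_lower_box //; have := ltn_ord i; lia.
have B0a i : a i \notin B0.
  by rewrite inE val_upper_box //; have := ltn_ord i; lia.
have alt_u : pair_alternating_row (n := n) a b u.
  split=> [i|x y out_x out_y].
    rewrite -scaleN1r; apply: symu; rewrite polytabloid_col_stab //.
      by rewrite odd_tperm neq_ab expr1.
    apply/col_stab1P => p; case: tpermP => [->|->|//].
      by rewrite box_col_lower // box_col_upper.
    by rewrite box_col_lower // box_col_upper.
  rewrite -[RHS]scale1r; apply: symu; rewrite scale1r polytabloid_outside // => i.
    by rewrite tpermD //; [have /andP[] := out_x i | have /andP[] := out_y i].
  by rewrite tpermD //; [have /andP[] := out_x i | have /andP[] := out_y i].
set mu := gram_eigenvalue F k a b B0.
have mu2 : 2 * mu = _ := gram_eigenvalueE F k_ge2 lt_kn co_nk a_inj b_inj cB0 B0b B0a.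
have eig_u : u *m set_gram F n k = mu *: u.
  exact: gram_eigenvector.
have gramU : U l *m set_gram F n k = mu *: U l.
  apply/eigenspaceP; apply: (submx_trans Uu); apply/sumsmx_subP => s _.
  rewrite genmxE; apply/eigenspaceP.
  by rewrite -mulmxA set_gram_comm // mulmxA eig_u scalemxAl.
have nz_mu : mu != 0.
  apply: contraNneq nz_poly => mu0; move/eqP: mu2; rewrite mu0 mulr0 eq_sym mulf_eq0.
  by rewrite pnatr_eq0 eqn0Ngt fact_gt0.
have nz_UPhi : U l *m Phi_mx F n k != 0.
  apply: contraNneq nz_u => UPhi0; move: gramU; rewrite set_gramE mulmxA UPhi0 mul0mx.
  move/esym/eqP; rewrite scaler_eq0 (negbTE nz_mu) /= => /eqP U0.
  by rewrite -submx0 -U0.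
rewrite -mu2; congr (_ * _); apply/eqP; rewrite -subr_eq0.
have : (c - mu) *: (U l *m Phi_mx F n k) == 0.
  rewrite scalerBl -eigU wreath_mx_gram // mulmxA -[_ *m _ *m _^T]mulmxA.
  by rewrite -set_gramE gramU scalemxAl subrr.
by rewrite scaler_eq0 (negbTE nz_UPhi) orbF.
Qed.

Theorem proposition4p9 (R : realType) (k l : nat) (hl : (2 <= l <= k)%N)
  (lambda : nat -> R[i])
  (hlambda : forall n : nat, (2 * k < n)%N -> coprime n k ->
     is_lambda n k l (lambda n))
  (P : {poly R[i]})
  (hP : forall n : nat, (2 * k < n)%N -> coprime n k ->
     lambda n = ((n - k - l)`!)%:R * P.[n%:R]) :
  root P l%:R /\ (odd l -> root P (2 * k)%:R).
Proof.
set Q := eigen_poly R[i] k l.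
suff PQ : 2%:R *: P = Q.
  have rootP x : root P x = root Q x by rewrite -PQ rootZ // pnatr_eq0.
  rewrite !rootP; split; first exact: eigen_poly_root_l.
  exact: eigen_poly_root_2k.
have nzQ : Q != 0 by apply: eigen_poly_neq0.
apply/eqP; rewrite -subr_eq0 -(mulIr_eq0 _ (mulIf nzQ)).
apply: contraT => nzD; set D := _ * Q in nzD.
(* The numbers j k + 1 are coprime to k, and j >= 3 makes them exceed 2 k. *)
pose rs := [seq ((j + 3) * k + 1)%:R : R[i] | j <- iota 0 (size D)].
have := max_poly_roots nzD (rs := rs); rewrite size_map size_iota ltnn; apply.
  apply/allP => _ /mapP[j _ ->]; set n := (_ + 1)%N.
  have lt_kn : (2 * k < n)%N by rewrite /n; nia.
  have co_nk : coprime n k by rewrite /coprime gcdnC gcdnMDl gcdn1.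
  rewrite /root hornerM; have [->|nzQn] := eqVneq Q.[n%:R] 0; first by rewrite mulr0.
  have := is_lambdaE hl lt_kn co_nk (hlambda n lt_kn co_nk) nzQn.
  rewrite hP // mulrCA => /mulfI eqPQ.
  rewrite hornerD hornerN hornerZ eqPQ ?subrr ?mul0r //.
  by rewrite pnatr_eq0 -lt0n fact_gt0.
rewrite map_inj_uniq ?iota_uniq // => i j /eqP; rewrite eqr_nat !addn1 eqSS eqn_pmul2r; last by lia.
by rewrite eqn_add2r => /eqP.
Qed.
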